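(* Let $G$ be a disconnected graph with $k \geq 2$ connected components, at least two of which are nontrivial (have at least two vertices). Then $h(G\overline{G}) = k+1$.
   Context: All graphs are finite, simple and undirected. For a graph $H$ and $x,y \in V(H)$, the closed interval $I[x,y]$ consists of $x$, $y$ and all vertices lying on some shortest path between $x$ and $y$ in $H$; for $S \subseteq V(H)$, $I[S] = \bigcup_{x,y\in S} I[x,y]$. A set $S$ is (geodetically) convex if $I[S]=S$; the convex hull $H(S)$ is the smallest convex set containing $S$; $S$ is a hull set if $H(S)=V(H)$; the (geodetic) hull number $h(H)$ is the minimum cardinality of a hull set of $H$. For a graph $G$ with vertex set $\{v_1,\dots,v_n\}$, the complementary prism $G\overline{G}$ has vertex set $\{v_1,\dots,v_n\}\cup\{\overline{v}_1,\dots,\overline{v}_n\}$ and edge set $E(G) \cup \{\overline{v}_i\overline{v}_j : i<j,\ v_iv_j\notin E(G)\} \cup \{v_i\overline{v}_i : 1\le i\le n\}$. A component is trivial if it has exactly one vertex, nontrivial otherwise. *)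

(* Defs.v *)
From mathcomp Require Import all_boot.

Set Implicit Arguments.
Unset Strict Implicit.
Unset Printing Implicit Defensive.

(* A finite simple graph is a symmetric irreflexive relation e on a finType. *)

Section GeodeticConvexity.

Variables (T : finType) (e : rel T).

(* As for [path], the path is x :: p; its length (number of edges) is size p. *)
Definition path_between (x y : T) (p : seq T) : bool :=
  [&& path e x p, last x p == y & uniq (x :: p)].

Definition shortest_path (x y : T) (n : nat) (p : n.-tuple T) : bool :=
  path_between x y p &&
  [forall m : 'I_n, ~~ [exists q : m.-tuple T, path_between x y q]].

(* A path has distinct vertices, so its length is less than #|T|; see
   in_intervalP for the form without the length bound. *)
Definition interval (x y : T) : {set T} :=
  [set z | [|| z == x, z == y |
    [exists n : 'I_#|T|, exists p : n.-tuple T,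
      shortest_path x y p && (z \in x :: p)]]].

Definition interval_set (S : {set T}) : {set T} :=
  \bigcup_(x in S) \bigcup_(y in S) interval x y.

Definition convex (S : {set T}) : bool := interval_set S == S.

(* The smallest convex superset of S; see hull_convex, sub_hull, hull_min. *)
Definition hull (S : {set T}) : {set T} :=
  \bigcap_(C : {set T} | convex C && (S \subset C)) C.

Definition hull_set (S : {set T}) : bool := hull S == [set: T].

Definition hull_number : nat :=
  #|[arg min_(S < [set: T] | hull_set S) #|S| ]|.

Definition components : {set {set T}} :=
  equivalence_partition (connect e) [set: T].

Definition nontrivial_components : {set {set T}} :=
  [set C in components | 1 < #|C|].

Lemma in_intervalP x y z :
  reflect [\/ z = x, z = y |
            exists p : seq T,
              [/\ path_between x y p,
                  forall q, path_between x y q -> size p <= size q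
                & z \in x :: p]]
          (z \in interval x y).
Proof.
apply: (iffP idP); rewrite inE.
  case/or3P=> [/eqP->|/eqP->|]; [by constructor 1|by constructor 2|].
  case/existsP=> n /existsP[p /andP[/andP[xyp /forallP min_p] zp]].
  constructor 3; exists p; split=> // q xyq; rewrite size_tuple leqNgt.
  apply/negP=> lt_qn; have /existsP := min_p (Ordinal lt_qn); apply.
  by exists (in_tuple q).
case=> [->|->|[p [xyp min_p zp]]]; rewrite ?eqxx ?orbT //.
apply/or3P; constructor 3.
have ltpT : size p < #|T|.
  have /and3P[_ _ /card_uniqP /= sz_p] := xyp; rewrite -sz_p; exact: max_card.
apply/existsP; exists (Ordinal ltpT); apply/existsP; exists (in_tuple p).
rewrite zp andbT; apply/andP; split=> //; apply/forallP=> m.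
apply/existsPn=> q; apply/negP=> /min_p; rewrite size_tuple leqNgt.
by rewrite (ltn_ord m).
Qed.

Lemma sub_interval_set (S : {set T}) : S \subset interval_set S.
Proof.
apply/subsetP=> x Sx; apply/bigcupP; exists x => //.
by apply/bigcupP; exists x; rewrite // inE eqxx.
Qed.

Lemma interval_setS (A B : {set T}) :
  A \subset B -> interval_set A \subset interval_set B.
Proof.
move=> sAB; apply/subsetP=> z /bigcupP[x Ax /bigcupP[y Ay zxy]].
apply/bigcupP; exists x; first exact: (subsetP sAB).
by apply/bigcupP; exists y; first exact: (subsetP sAB).
Qed.

Lemma sub_hull (S : {set T}) : S \subset hull S.
Proof. by apply/bigcapsP=> C /andP[]. Qed.

Lemma hull_min (S C : {set T}) : convex C -> S \subset C -> hull S \subset C.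
Proof. by move=> cC sSC; apply: bigcap_inf; rewrite cC. Qed.

Lemma hull_convex S : convex (hull S).
Proof.
rewrite /convex eqEsubset sub_interval_set andbT.
apply/bigcapsP=> C /andP[cC sSC].
by rewrite -(eqP cC) interval_setS // hull_min.
Qed.

Lemma hull_set_setT : hull_set [set: T].
Proof. by rewrite /hull_set -subTset sub_hull. Qed.

Lemma hull_numberP :
  (exists2 S, hull_set S & #|S| = hull_number) /\
  (forall S, hull_set S -> hull_number <= #|S|).
Proof.
rewrite /hull_number; case: arg_minnP; first exact: hull_set_setT.
by move=> S hS minS; split; [exists S|].
Qed.

End GeodeticConvexity.

(* inl v is the vertex v of G, inr v its copy in the complement of G. *)
Definition cprism (T : finType) (e : rel T) : rel (T + T)%type :=
  fun u v => match u, v with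
  | inl x, inl y => e x y
  | inr x, inr y => (x != y) && ~~ e x y
  | inl x, inr y | inr x, inl y => x == y
  end.

Lemma cprism_sym (T : finType) (e : rel T) :
  symmetric e -> symmetric (cprism e).
Proof.
by move=> se [x|x] [y|y] /=; rewrite ?(se x) // ?[y == x]eq_sym // eq_sym.
Qed.

Lemma cprism_irr (T : finType) (e : rel T) :
  irreflexive e -> irreflexive (cprism e).
Proof. by move=> ie [x|x] /=; rewrite ?ie ?eqxx. Qed.

(* Main.v *)
Require Import Defs.
From mathcomp Require Import all_boot.

Set Implicit Arguments.
Unset Strict Implicit.
Unset Printing Implicit Defensive.

(** Lower bound: a geodesic cannot enter and leave the copy in [G] of a
    component, since it would contain a subpath of length at least 3 between
    two vertices of the complement, which has diameter at most 2.  Hence the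
    vertices outside that copy form a convex set, and a hull set meets each of
    the [k] copies.  If it has just [k] elements, it picks one vertex [v] per
    component; all these [v] and their complement copies then form a convex
    set, which is proper because some component is nontrivial.

    Upper bound: take one vertex per component and, for one nontrivial
    component, the complement copy of a neighbour of its representative.
    Geodesics of length 2 first reach the complement copy of every vertex
    outside that component, then of every vertex because a second component is
    nontrivial; finally each representative reaches its whole component. *)

(** * Geodesics and convex sets in an arbitrary graph *)

Section Geodesics.

Variables (T : finType) (e : rel T).

Definition geodesic (x y : T) (p : seq T) : Prop :=
  path_between e x y p /\ forall q, path_between e x y q -> size p <= size q.

(** Any walk shortens to a path, so a competitor [q] need not be shown free of repetitions. *)
Lemma geodesic_min x y p q :
  geodesic x y p -> path e x q -> last x q = y -> size p <= size q.
Proof.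
case=> _ min_p /shortenP[q' xq' uq' sub_q'] lq'.
apply: leq_trans (min_p q' _) _.
  by rewrite /path_between xq' lq' eqxx uq'.
by apply: uniq_leq_size => //; case/andP: uq'.
Qed.

Lemma geodesic_convex (C : {set T}) :
    (forall x y p, x \in C -> y \in C -> geodesic x y p -> {subset p <= C}) ->
  convex e C.
Proof.
move=> sC; rewrite /convex eqEsubset sub_interval_set andbT.
apply/subsetP=> z /bigcupP[x Cx /bigcupP[y Cy /in_intervalP]].
case=> [->|->|[p [xyp min_p]]] //.
rewrite inE => /predU1P[->|] //; exact: (sC x y p).
Qed.

(** The ends are at distance exactly 2, so the path through [z] is a geodesic. The upper bound uses
    no other geodesics. *)
Lemma convex_midpoint (C : {set T}) x y z :
    convex e C -> x \in C -> y \in C -> e x z -> e z y ->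
    x != y -> ~~ e x y -> x != z -> z != y ->
  z \in C.
Proof.
move=> /eqP cC Cx Cy exz ezy nxy nexy nxz nzy; rewrite -cC.
apply/bigcupP; exists x => //; apply/bigcupP; exists y => //.
apply/in_intervalP; constructor 3; exists [:: z; y]; split.
- by rewrite /path_between /= exz ezy eqxx !inE negb_or nxz nxy nzy.
- case=> [|a [|b q]] //; first by rewrite /path_between /= (negPf nxy).
  by case/and3P=> /= /andP[exa _] /eqP Day; rewrite -Day exa in nexy.
- by rewrite !inE eqxx orbT.
Qed.

End Geodesics.

Lemma not_connect_nonadj (T : finType) (e : rel T) x y :
  ~~ connect e x y -> x != y /\ ~~ e x y.
Proof.
move=> nxy; split; first by apply: contraNneq nxy => ->.
by apply: contra nxy; apply: connect1.
Qed.

(** * Connected components and their canonical representatives *)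

Section Components.

Variables (T : finType) (e : rel T).
Hypothesis e_sym : symmetric e.

Let cl x := [set y in [set: T] | connect e x y].

Lemma eq_component x y : (cl x == cl y) = connect e x y.
Proof.
have csym := sym_connect_sym e_sym; apply/eqP/idP=> [/setP/(_ y)|cxy].
  by rewrite !inE connect0.
by apply/setP=> z; rewrite !inE (same_connect csym cxy).
Qed.

Lemma componentsE : components e = cl @: [set: T].
Proof. by []. Qed.

Lemma nontrivial_componentP C :
    C \in nontrivial_components e ->
  exists x y, [/\ C = cl x, root e x = x & e x y].
Proof.
have csym := sym_connect_sym e_sym.
rewrite inE => /andP[/imsetP[x0 _ DC] gt1].
have DCx : C = cl (root e x0).
  by rewrite DC; apply/eqP; rewrite -/(cl x0) eq_component connect_root.
exists (root e x0).
case/card_gt1P: gt1 => a [b [Ca Cb nab]].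
have [c Cc nxc]: exists2 c, c \in C & root e x0 != c.
  have [Da|] := eqVneq (root e x0) a; first by exists b; rewrite ?Da.
  by exists a.
move: Cc; rewrite {1}DCx !inE /= => /connectP[[|y p]] /=.
  by move=> _ Dc; rewrite Dc eqxx in nxc.
by case/andP=> ey _ _; exists y; rewrite root_root.
Qed.

Lemma not_connect_exists x :
  1 < #|components e| -> exists z, ~~ connect e x z.
Proof.
rewrite componentsE => /card_gt1P[_ [_ [/imsetP[a _ ->] /imsetP[b _ ->]]]].
rewrite eq_component => nab.
case cxa: (connect e x a); last by exists a; rewrite cxa.
by exists b; rewrite (same_connect (sym_connect_sym e_sym) cxa).
Qed.

End Components.

(** * Every hull set has more than [k] elements *)

Section LowerBound.

Variables (T : finType) (e : rel T).
Hypotheses (e_sym : symmetric e) (e_irr : irreflexive e).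
Hypothesis disconnected : 1 < #|components e|.

(** If [x] and [y] are adjacent in the graph, the complement copy of any vertex [z] of another
    component is adjacent to both of theirs. *)
Lemma geodesic_inr x y p :
  geodesic (cprism e) (inr x) (inr y) p -> size p <= 2.
Proof.
move=> gp; have le_p q := geodesic_min (q := q) gp.
have [Dxy|nxy] := eqVneq x y.
  by apply: leq_trans (le_p [::] _ _) _; rewrite ?Dxy.
have [exy|nexy] := boolP (e x y); last first.
  by apply: leq_trans (le_p [:: inr y] _ _) _; rewrite //= nxy nexy.
have [z nxz] := not_connect_exists e_sym x disconnected.
have nyz : ~~ connect e y z.
  by apply: contra nxz; apply: connect_trans; apply: connect1.
have [z1 z2] := not_connect_nonadj nxz; have [z3 z4] := not_connect_nonadj nyz.
by apply: (le_p [:: inr z; inr y]); rewrite //= z1 z2 eq_sym z3 e_sym z4.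
Qed.

(** If [e x y], walk along this edge in the graph and cross at [y]; otherwise cross at [x] and walk
    in the complement. *)
Lemma geodesic_inl_inr x y p :
    geodesic (cprism e) (inl x) (inr y) p \/
    geodesic (cprism e) (inr y) (inl x) p ->
  size p <= 2.
Proof.
have [->|nxy] := eqVneq x y.
  case=> gp.
    by apply: leq_trans (geodesic_min (q := [:: inr y]) gp _ _) _;
      rewrite /= ?eqxx.
  by apply: leq_trans (geodesic_min (q := [:: inl y]) gp _ _) _;
    rewrite /= ?eqxx.
case exy: (e x y).
  case=> gp.
    by apply: (geodesic_min (q := [:: inl y; inr y]) gp);
      rewrite /= ?exy ?eqxx.
  by apply: (geodesic_min (q := [:: inl y; inl x]) gp);
    rewrite /= 1?e_sym ?exy ?eqxx.
case=> gp.
  by apply: (geodesic_min (q := [:: inr x; inr y]) gp);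
    rewrite /= ?exy ?nxy ?eqxx.
by apply: (geodesic_min (q := [:: inr x; inl x]) gp);
  rewrite /= 1?e_sym ?exy 1?eq_sym ?nxy ?eqxx.
Qed.

(** The detour [inl x], [inr x], [inr y], [inl y] settles the worst case. The bound makes it
    possible to enumerate all geodesics by length. *)
Lemma geodesic_cprism_size u v p : geodesic (cprism e) u v p -> size p <= 3.
Proof.
case: u v => [x|x] [y|y] gp.
- have [Dxy|nxy] := eqVneq x y.
    by apply: leq_trans (geodesic_min (q := [::]) gp _ _) _; rewrite ?Dxy.
  case exy: (e x y).
    by apply: leq_trans (geodesic_min (q := [:: inl y]) gp _ _) _;
      rewrite //= exy.
  by apply: (geodesic_min (q := [:: inr x; inr y; inl y]) gp);
    rewrite //= exy nxy !eqxx.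
- by apply: leqW; apply: (@geodesic_inl_inr x y); left.
- by apply: leqW; apply: (@geodesic_inl_inr y x); right.
- by apply: leqW; apply: geodesic_inr gp.
Qed.

Lemma convex_component_compl x :
  convex (cprism e) (~: (inl @: [set y in [set: T] | connect e x y])).
Proof.
set D := inl @: _.
have DP u : reflect (exists2 c, u = inl c & connect e x c) (u \in D).
  apply: (iffP imsetP) => [[c cP ->]|[c -> xc]]; exists c => //.
    by rewrite !inE in cP.
  by rewrite !inE.
(* The only edges leaving [D] join a vertex to its own complement copy. *)
have exit u v : u \in D -> v \notin D -> cprism e u v || cprism e v u ->
    exists2 c, u = inl c & v = inr c.
  case/DP=> c -> xc; case: v => [v|v] /= nDv.
    rewrite [e v c]e_sym orbb => ecv; case/negP: nDv; apply/DP; exists v => //.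
    exact: connect_trans xc (connect1 ecv).
  by rewrite [v == c]eq_sym orbb => /eqP->; exists v.
apply: geodesic_convex => u v p; rewrite !inE => nu nv gp.
have := geodesic_cprism_size gp; have [/and3P[up /eqP lp Up] _] := gp.
case: p => [|a [|b [|c [|//]]]] in gp up lp Up *; simpl in *; subst=> _ z.
- by [].
- by rewrite !inE => /eqP->.
- rewrite !inE => /orP[] /eqP-> //; apply/negP=> Da.
  case/and3P: up => ua av _.
  (* Both neighbours of [a] on the path would be its complement copy. *)
  have [|c Da1 Du] := exit a u Da nu; first by rewrite ua orbT.
  have [|d Da2 Dv] := exit a v Da nv; first by rewrite av.
  by move: Da2 Up; rewrite Du Dv Da1 => -[->]; rewrite !inE eqxx !orbT.
case/and4P: up => ua ab bv _.
have [Da|nDa] := boolP (a \in D).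
  have [|s Da1 Du] := exit a u Da nu; first by rewrite ua orbT.
  have [Db|nDb] := boolP (b \in D).
    have [|t Db1 Dv] := exit b v Db nv; first by rewrite bv.
    by rewrite Du Dv in gp; have := geodesic_inr gp.
  have [|d Da2 Dv] := exit a b Da nDb; first by rewrite ab.
  by move: Da2 Up; rewrite Du Dv Da1 => -[->]; rewrite !inE eqxx !orbT.
have [Db|nDb] := boolP (b \in D).
  have [|s Db1 Du] := exit b a Db nDa; first by rewrite ab orbT.
  have [|d Db2 Dv] := exit b v Db nv; first by rewrite bv.
  by move: Db2 Up; rewrite Du Dv Db1 => -[->]; rewrite !inE eqxx !(orbT, andbF).
by rewrite !inE => /or3P[] /eqP->.
Qed.

Lemma convex_transversal_prism (X : {set T}) :
    {in X &, forall x y, connect e x y -> x = y} ->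
  convex (cprism e) (inl @: X :|: inr @: X).
Proof.
move=> injX; set W := _ :|: _.
have Wl x : (inl x \in W) = (x \in X).
  rewrite inE mem_imset; last by move=> ? ? [].
  by case: imsetP => [[]|] //; rewrite orbF.
have Wr x : (inr x \in W) = (x \in X).
  rewrite inE orbC mem_imset; last by move=> ? ? [].
  by case: imsetP => [[]|] //; rewrite orbF.
apply: geodesic_convex => u v p Wu Wv gp.
have := geodesic_cprism_size gp; have [/and3P[up /eqP lp Up] _] := gp.
case: p => [|a [|b [|c [|//]]]] in gp up lp Up *; simpl in *; subst=> _ z.
- by [].
- by rewrite mem_seq1 => /eqP->.
- rewrite in_cons mem_seq1 => /orP[] /eqP-> //.
  case/and3P: up => ua av _.
  case: u v a Wu Wv ua av Up gp => [x|x] [y|y] [a|a] /=;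
    rewrite ?(Wl, Wr) // => Xx Xy.
  + move=> exa eay; rewrite (injX x y) ?inE ?eqxx ?orbT //.
    exact: connect_trans (connect1 exa) (connect1 eay).
  + by move=> /eqP<-.
  + move=> exa /eqP Da; rewrite Da in exa.
    by have Dxy := injX x y Xx Xy (connect1 exa); rewrite Dxy e_irr in exa.
  + by move=> /eqP<-.
  + by move=> /eqP<-.
  + by move=> _ /eqP->.
  + by move=> /eqP-> /eqP->; rewrite !inE eqxx ?orbT.
  (* Distinct vertices of [X] have adjacent complement copies, so a path of length 2 is too long. *)
  + move=> _ _ Up gp; have := geodesic_min (q := [:: inr y]) gp.
    have nxy : x != y by apply: contraTneq Up => ->; rewrite !inE eqxx orbT.
    have nexy : ~~ e x y.
      by apply: contra nxy => /connect1/injX-> //.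
    by rewrite /= nxy nexy => /(_ isT erefl).
case/and4P: up => ua ab bv _.
case: u v Wu Wv ua ab bv Up gp => [x|x] [y|y] Wu Wv ua ab bv Up gp;
  last by have := geodesic_inr gp.
- rewrite !Wl in Wu Wv.
  case: a b ua ab bv Up {gp} => [a|a] [b|b] /=.
  + move=> exa eab eby; rewrite (injX x y) ?inE ?eqxx ?orbT //.
    apply: connect_trans (connect1 exa) _.
    exact: connect_trans (connect1 eab) (connect1 eby).
  + by move=> _ /eqP-> /eqP->; rewrite !inE eqxx ?(andbF, orbT).
  + by move=> /eqP-> /eqP->; rewrite !inE eqxx ?(andbF, orbT).
  (* The surviving shape is [inl x], [inr x], [inr y], [inl y], which stays inside [W]. *)
  + by move=> /eqP<- _ /eqP-> _; rewrite !in_cons in_nil orbF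
      => /or3P[] /eqP->; rewrite ?Wl ?Wr.
- by have := @geodesic_inl_inr x y _ (or_introl gp).
- by have := @geodesic_inl_inr y x _ (or_intror gp).
Qed.

Lemma hull_set_cprism_card (S : {set T + T}) :
    0 < #|nontrivial_components e| -> hull_set (cprism e) S ->
  #|components e| < #|S|.
Proof.
move=> nontriv /eqP hullS.
pose cl x := [set y in [set: T] | connect e x y].
pose X := [set x | inl x \in S].
have injl : injective (@inl T T) by move=> ? ? [].
have sXS : inl @: X \subset S by apply/subsetP=> _ /imsetP[x + ->]; rewrite inE.
have cardX : #|inl @: X : {set T + T}| = #|X| by rewrite card_imset.
have meet x : exists2 y, y \in X & connect e x y.
  have [|/subsetPn[u Su]] := boolP (S \subset ~: (inl @: cl x)).
    move/(hull_min (convex_component_compl x)); rewrite hullS.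
    move/subsetP/(_ (inl x)).
    by rewrite !inE mem_imset // !inE connect0 => /(_ isT).
  rewrite inE negbK => /imsetP[y]; rewrite !inE => xy Du.
  by exists y; rewrite // inE -Du.
have sCX : components e \subset cl @: X.
  apply/subsetP=> _ /imsetP[x _ ->]; have [y Xy xy] := meet x.
  by apply/imsetP; exists y => //; apply/eqP; rewrite -/(cl x) eq_component.
have leCX := subset_leq_card sCX; have leX := leq_imset_card cl X.
have leXS := subset_leq_card sXS; rewrite cardX in leXS.
(* Now the chain [#|components e| <= #|cl @: X| <= #|X| <= #|S|] is tight: [S] lies in the copy of
   the graph, and [X] has one vertex per component. *)
rewrite ltnNge; apply/negP=> leSC.
have SX : inl @: X = S.
  apply/eqP; rewrite eqEcard sXS cardX.
  exact: leq_trans leSC (leq_trans leCX leX).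
have /imset_injP injX : #|cl @: X| == #|X|.
  by rewrite eqn_leq leX (leq_trans leXS) // (leq_trans leSC).
have injX' : {in X &, forall x y, connect e x y -> x = y}.
  by move=> x y Xx Xy xy; apply: injX => //; apply/eqP; rewrite eq_component.
have := hull_min (convex_transversal_prism injX') (S := S).
rewrite hullS -{1}SX subsetUl => /(_ isT)/subsetP sTW.
have XT x : x \in X.
  have := sTW (inl x) (in_setT _).
  by rewrite inE mem_imset //; case: imsetP => [[]|] //; rewrite orbF.
case/card_gt0P: nontriv => C /(nontrivial_componentP e_sym)[x [y [_ _ exy]]].
by have := exy; rewrite (injX' x y) ?connect1 // e_irr.
Qed.

End LowerBound.

(** * A hull set with at most [k + 1] elements *)

Section UpperBound.

Variables (T : finType) (e : rel T).
Hypotheses (e_sym : symmetric e) (e_irr : irreflexive e).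

Lemma convex_cprism_nonadj (K : {set T + T}) x y :
    convex (cprism e) K -> inl x \in K -> inr y \in K -> x != y -> ~~ e x y ->
  inr x \in K.
Proof.
move=> cK Kx Ky nxy nexy.
by apply: (convex_midpoint (x := inl x) (y := inr y) cK); rewrite //= nxy.
Qed.

Lemma convex_cprism_adj (K : {set T + T}) x y :
    convex (cprism e) K -> inl x \in K -> inr y \in K -> e x y ->
  inl y \in K.
Proof.
move=> cK Kx Ky exy.
have nxy : x != y by apply: contraTneq exy => ->; rewrite e_irr.
by apply: (convex_midpoint (x := inl x) (y := inr y) cK); rewrite /= ?eqxx.
Qed.

(** The copies of [x] and [y] are not adjacent in the complement, and that of [z] is a common
    neighbour. *)
Lemma convex_cprism_compl (K : {set T + T}) x y z :
    convex (cprism e) K -> inr x \in K -> inr y \in K -> e x y ->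
  ~~ connect e x z -> inr z \in K.
Proof.
move=> cK Kx Ky exy nxz.
have nxy : x != y by apply: contraTneq exy => ->; rewrite e_irr.
have nyz : ~~ connect e y z.
  by apply: contra nxz; apply: connect_trans; apply: connect1.
have [z1 z2] := not_connect_nonadj nxz; have [z3 z4] := not_connect_nonadj nyz.
have z3' : z != y by rewrite eq_sym.
apply: (convex_midpoint (x := inr x) (y := inr y) cK) => //=.
- by rewrite z1.
- by rewrite z3' e_sym.
- by rewrite negb_and exy orbT.
Qed.

Lemma hull_set_cprism_exists :
    1 < #|nontrivial_components e| ->
  exists2 S : {set T + T}, hull_set (cprism e) S & #|S| <= #|components e|.+1.
Proof.
have csym := sym_connect_sym e_sym.
case/card_gt1P=> A [B [/(nontrivial_componentP e_sym)[v [w [-> rv evw]]]]].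
case/(nontrivial_componentP e_sym)=> [u [w' [-> ru euw']]].
rewrite eq_component // => nvu.
pose X := root e @: [set: T].
have Xroot x : root e x \in X by apply: imset_f.
exists (inr w |: inl @: X); last first.
  rewrite cardsU1 (leq_trans (n := (#|inl @: X : {set T + T}|).+1)) //.
    by case: (_ \notin _).
  rewrite ltnS card_imset; last by move=> ? ? [].
  have injX :
      {in X &, injective (fun x => [set y in [set: T] | connect e x y])}.
    move=> _ _ /imsetP[x _ ->] /imsetP[y _ ->] /eqP.
    by rewrite eq_component // -root_connect // !root_root // => /eqP.
  rewrite -(card_in_imset injX); apply: subset_leq_card.
  by apply/subsetP=> _ /imsetP[x _ ->]; apply: imset_f.
set S := _ |: _; have cK := hull_convex (cprism e) S.
rewrite /hull_set; set K := hull _ S in cK *.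
have sSK := subsetP (sub_hull (cprism e) S); rewrite -/K in sSK.
have Kl x : inl (root e x) \in K.
  by apply: sSK; rewrite !inE imset_f ?Xroot ?orbT.
have Kv : inl v \in K by rewrite -rv.
have Ku : inl u \in K by rewrite -ru.
have Kw : inr w \in K by apply: sSK; rewrite !inE eqxx.
have nuv : ~~ connect e u v by rewrite csym.
have nuw : ~~ connect e u w.
  by apply: contra nuv => /connect_trans; apply; apply: connect1; rewrite e_sym.
have [n1 n2] := not_connect_nonadj nuw; have [n3 n4] := not_connect_nonadj nvu.
have Kru : inr u \in K by apply: convex_cprism_nonadj cK Ku Kw n1 n2.
have Krv : inr v \in K by apply: convex_cprism_nonadj cK Kv Kru n3 n4.
have Kw' : inr w' \in K.
  apply: convex_cprism_compl cK Krv Kw evw _; apply: contra nvu.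
  by move/connect_trans; apply; apply: connect1; rewrite e_sym.
(* The edge [v w] yields all copies outside the component of [v]; the edge [u w'], in another
   component, yields the remaining ones. *)
have Kr z : inr z \in K.
  have [vz|] := boolP (connect e v z); last first.
    exact: convex_cprism_compl cK Krv Kw evw.
  apply: convex_cprism_compl cK Kru Kw' euw' _; apply: contra nuv => uz.
  by apply: connect_trans uz _; rewrite csym.
apply/eqP/setP=> -[x|x]; rewrite inE ?Kr //.
(* Membership in [K] propagates along a path from the representative, since the complement copy of
   each next vertex is already in [K]. *)
have /connectP[p] : connect e (root e x) x by rewrite csym connect_root.
move: (Kl x); elim: p (root e x) => [|b p IHp] a Ka /=.
  by move=> _ ->.
case/andP=> eab; apply: IHp.
exact: convex_cprism_adj cK Ka (Kr b) eab.
Qed.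

End UpperBound.

Theorem theorem3 (T : finType) (e : rel T) (k : nat) :
  symmetric e -> irreflexive e ->
  #|components e| = k -> 2 <= k ->
  2 <= #|nontrivial_components e| ->
  hull_number (cprism e) = k.+1.
Proof.
move=> e_sym e_irr <- ge2k ge2n.
have [[S hS <-] minS] := hull_numberP (cprism e).
apply/eqP; rewrite eqn_leq andbC hull_set_cprism_card ?(ltnW ge2n) //=.
have [S' hS' leS'] := hull_set_cprism_exists e_sym e_irr ge2n.
exact: leq_trans (minS _ hS') leS'.
Qed.
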